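(* Let $(X,\delta_s^{2})$ be a relator space, let $n\ge 2$ be an integer, and let $\{A_i\}_{i=1,\dots,n}$ be a family of subsets of $X$ that forms a $\delta_s^{2}$-hyperconnected chain. Construct the simple graph whose vertices are the members $A_1,\dots,A_n$ of the family (one vertex for each index $i$), with an edge between the vertices $A_i$ and $A_j$, $i\neq j$, exactly when $\delta_s^{2}(A_i,A_j)=0$. Then this graph is a path graph $P_n$.
   Context: A relator space $(X,\delta_s^{2})$ is a topological space $X$ equipped with a strong hyperconnectedness relation $\delta_s^{2}$, i.e. a function assigning to each pair of subsets $A,B\subset X$ a value $\delta_s^{2}(A,B)\in\{0,1\}$, where $0$ means the sets are (strongly) near and $1$ means they are far; $\delta_s^{2}(A,B)=0$ implies that the interiors of $A$ and $B$ have nonempty intersection. A family $\{A_i\}_{i=1,\dots,n}$ of subsets of $X$ is a $\delta_s^{2}$-hyperconnected chain if for all indices $i,j$: $|i-j|\le 1$ implies $\delta_s^{2}(A_i,A_j)=0$, and $|i-j|>1$ implies $\delta_s^{2}(A_i,A_j)=1$. Graphs are simple: no edges from a vertex to itself and no multiple edges. A cycle is a route along edges from a vertex back to itself passing through other vertices, in which no edge is repeated and no vertex other than the start/end vertex is repeated. A tree is a (connected) graph with no cycles. A path graph $P_n$ is a tree with $n$ vertices, two of which have degree $1$ and the remaining $n-2$ of which have degree $2$. *)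

(* Defs.v *)
(* MathComp world (with MathComp-Analysis for topological spaces). *)
From HB Require Import structures.
From mathcomp Require Import all_boot all_order all_algebra.
From mathcomp Require Import all_classical topology.

Set Implicit Arguments.
Unset Strict Implicit.
Unset Printing Implicit Defensive.

Import IntDist.

Local Open Scope classical_set_scope.
Local Open Scope ring_scope.

(* The value 0 means "near" and the value 1 means "far". *)
Definition strong_hyperconnectedness (X : topologicalType)
    (delta : set X -> set X -> 'I_2) : Prop :=
  forall A B : set X, delta A B = 0 -> interior A `&` interior B !=set0.

Record relator_space := RelatorSpace {
  relator_carrier :> topologicalType;
  delta_s2 : set relator_carrier -> set relator_carrier -> 'I_2;
  delta_s2P : strong_hyperconnectedness delta_s2
}.

(* The indices 1, ..., n are shifted to 0, ..., n - 1. *)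
Definition hyperconnected_chain (X : relator_space) (n : nat)
    (A : 'I_n -> set X) : Prop :=
  forall i j : 'I_n,
    ((`|i - j| <= 1)%N -> delta_s2 (A i) (A j) = 0) /\
    ((1 < `|i - j|)%N -> delta_s2 (A i) (A j) = 1).

(* Vertices are indices, so equal members A i = A j with i != j would still be
   two vertices. *)
Definition family_graph (X : relator_space) (n : nat) (A : 'I_n -> set X) :
    rel 'I_n :=
  [rel i j | (i != j) && (delta_s2 (A i) (A j) == 0)].

Section Graphs.
Variable V : finType.
Implicit Types (e : rel V) (c : seq V).

Definition simple_graph e : Prop := symmetric e /\ irreflexive e.

(* The undirected edges used by the closed route c_0, c_1, ..., c_k, c_0. *)
Definition route_edges c : seq {set V} := [seq [set x; next c x]%SET | x <- c].

(* The route is closed up implicitly: c lists each vertex once, without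
   repeating the start vertex at the end. Going back and forth along one edge
   is excluded by the last conjunct. *)
Definition graph_cycle e c : Prop :=
  [/\ (1 < size c)%N, cycle e c, uniq c & uniq (route_edges c)].

Definition connected_graph e : Prop := forall x y : V, connect e x y.

Definition tree e : Prop :=
  [/\ simple_graph e, connected_graph e & forall c, ~ graph_cycle e c].

Definition degree e (x : V) : nat := #|[set y | e x y]%SET|.

Definition path_graph (n : nat) e : Prop :=
  [/\ tree e, #|V| = n,
      #|[set x | degree e x == 1%N]%SET| = 2%N &
      #|[set x | degree e x == 2%N]%SET| = (n - 2)%N].

End Graphs.

(* Main.v *)
(* The chain condition says that the graph has an edge between i and j exactly
   when |i - j| = 1. At the largest vertex m of a cycle, both neighbours along
   the cycle are at most m and adjacent to m, so both are m - 1, and the cycle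
   uses the edge {m - 1, m} twice. *)
Require Import Defs.
From mathcomp Require Import all_boot all_order all_algebra.
From mathcomp Require Import all_classical topology.
From mathcomp Require Import zify.

Lemma uniq_map_in_inj (T T' : eqType) (f : T -> T') (s : seq T) :
  uniq (map f s) -> {in s &, injective f}.
Proof.
elim: s => [//|a s IHs] /= /andP[fa /IHs inj_f] x y.
rewrite !inE => /predU1P[->|xs] /predU1P[->|ys] // fxy.
- by rewrite fxy map_f in fa.
- by rewrite -fxy map_f in fa.
- exact: inj_f.
Qed.

(** If both neighbours of [x] along [c] agreed, the edges leaving [x] and [prev c x] would be the
    same. Since edges are not repeated, [x = prev c x], which is a loop at [x]. *)
Lemma graph_cycle_next_neq_prev (V : finType) (e : rel V) (c : seq V) (x : V) :
  irreflexive e -> graph_cycle e c -> x \in c -> next c x <> prev c x.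
Proof.
move=> e_irr [_ ce uc ue] xc next_eq_prev.
have edges_eq : [set x; next c x]%SET = [set prev c x; next c (prev c x)]%SET.
  by rewrite next_eq_prev next_prev // finset.setUC.
have x_prev : x = prev c x.
  by apply: (uniq_map_in_inj _ _ _ _ ue); rewrite ?mem_prev.
by have := prev_cycle ce xc; rewrite -x_prev e_irr.
Qed.

Lemma card_ord_eq (n k : nat) : #|[set y : 'I_n | val y == k]%SET| = (k < n)%N.
Proof.
case: (ltnP k n) => [kn | nk].
  rewrite (_ : [set _ | _]%SET = [set Ordinal kn]%SET) ?cards1 //.
  by apply/finset.setP => y; rewrite !inE.
apply/eqP; rewrite cards_eq0; apply/eqP/finset.setP => y; rewrite !inE /=.
by apply/negbTE; have := ltn_ord y; lia.
Qed.

Section LinearGraph.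
Variables (n : nat) (e : rel 'I_n).
Hypothesis eE : forall i j : 'I_n, e i j = (i.+1 == j) || (j.+1 == i).

Lemma linear_sym : symmetric e.
Proof. by move=> i j; rewrite !eE orbC. Qed.

Lemma linear_irr : irreflexive e.
Proof. by move=> i; rewrite eE; lia. Qed.

Lemma linear_connected : connected_graph e.
Proof.
(* Climb from [i] to [j] one index at a time; the vertex [i + k] reached before the last step exists
   because it lies below [j]. *)
have up (k : nat) (i j : 'I_n) : (j = i + k :> nat)%N -> connect e i j.
  elim: k i j => [|k IHk] i j ij.
    by rewrite (_ : i = j) //; apply: val_inj => /=; lia.
  have lt_n : (i + k < n)%N by have := ltn_ord j; lia.
  apply: (connect_trans (IHk i (Ordinal lt_n) erefl)).
  by apply: connect1; rewrite eE /=; lia.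
move=> i j; case: (leqP i j) => [ij | /ltnW ji].
  by apply: (up (j - i)%N); lia.
by rewrite (sym_connect_sym linear_sym); apply: (up (i - j)%N); lia.
Qed.

Lemma linear_acyclic (c : seq 'I_n) : ~ graph_cycle e c.
Proof.
move=> cyc; have [szc ce _ _] := cyc.
have [x xc] : exists x, x \in c.
  by case: c szc {cyc ce} => // x c; exists x; rewrite mem_head.
have [m mc m_max] := @arg_maxnP _ x (mem c) val xc.
apply: (graph_cycle_next_neq_prev _ _ _ _ linear_irr cyc mc).
apply: val_inj => /=.
have := next_cycle ce mc; have := prev_cycle ce mc; rewrite !eE.
have /= := m_max (next c m); rewrite mem_next => /(_ mc).
have /= := m_max (prev c m); rewrite mem_prev => /(_ mc).
(* Abstracting the three indices leaves pure arithmetic: a number at most [m] and at distance 1 from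
   [m] is [m - 1]. *)
by move: (nat_of_ord m) (nat_of_ord (next c m)) (nat_of_ord (prev c m)); lia.
Qed.

Lemma linear_tree : tree e.
Proof.
split; [|exact: linear_connected|exact: linear_acyclic].
by split; [exact: linear_sym|exact: linear_irr].
Qed.

Lemma linear_degree (x : 'I_n) : degree e x = ((0 < x) + (x.+1 < n))%N.
Proof.
have ->: degree e x =
    (* The guard [0 < x] matters because [0.-1 = 0]: without it, vertex 0 would count as its own
       left neighbour. *)
    #|[set y : 'I_n | (0 < x)%N && (val y == x.-1)]
      :|: [set y : 'I_n | val y == x.+1]|%SET.
  by congr #|pred_of_set _|; apply/finset.setP => y; rewrite !inE eE /=; lia.
rewrite cardsU (_ : _ :&: _ = finset.set0)%SET; last first.
  by apply/finset.setP => y; rewrite !inE /=; lia.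
rewrite cards0 subn0 card_ord_eq; congr addn.
case: (posnP x) => [_|x0] /=.
  by apply/eqP; rewrite cards_eq0; apply/eqP/finset.setP => y; rewrite !inE /=.
by rewrite card_ord_eq; have := ltn_ord x; lia.
Qed.

End LinearGraph.

Lemma linear_path_graph (n : nat) (e : rel 'I_n) :
  (2 <= n)%N -> (forall i j : 'I_n, e i j = (i.+1 == j) || (j.+1 == i)) ->
  path_graph n e.
Proof.
(* Writing the order as [n.+2] makes [ord0] and [ord_max] available and distinct; these are the two
   endpoints, and all other vertices have degree 2. *)
case: n e => [|[|n]] // e _ eE.
have deg1 : [set x | degree e x == 1%N]%SET = [set ord0; ord_max]%SET.
  apply/finset.setP => x; rewrite !inE (linear_degree _ _ eE) -!val_eqE /=.
  by have := ltn_ord x; lia.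
have deg2 : [set x | degree e x == 2%N]%SET = (~: [set ord0; ord_max])%SET.
  apply/finset.setP => x; rewrite !inE (linear_degree _ _ eE) -!val_eqE /=.
  by have := ltn_ord x; lia.
split; first exact: linear_tree.
- exact: card_ord.
- by rewrite deg1 cards2.
- by rewrite deg2 cardsCs finset.setCK cards2 card_ord.
Qed.

(** Distance at least 2 gives the value 1, hence no edge. Distance at most 1 gives the value 0, and
    [i != j] discards distance 0, so only consecutive indices remain. *)
Lemma family_graph_chainE (X : relator_space) (n : nat) (A : 'I_n -> set X) :
  hyperconnected_chain A ->
  forall i j : 'I_n, family_graph A i j = (i.+1 == j) || (j.+1 == i).
Proof.
move=> hA i j; rewrite /family_graph /=; have [near far] := hA i j.
rewrite -val_eqE /=; case: leqP near far => [ij /(_ isT) -> _|ij _ /(_ isT) ->].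
  by rewrite eqxx andbT; lia.
by rewrite (_ : (1 == 0 :> 'I_2)%R = false) // andbF; lia.
Qed.

Theorem theorem4 (X : relator_space) (n : nat) (hn : (2 <= n)%N)
    (A : 'I_n -> set X) (hA : hyperconnected_chain A) :
  path_graph n (family_graph A).
Proof. exact: linear_path_graph hn (family_graph_chainE _ _ _ hA). Qed.
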